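(* Let $B>0$, let $\mathfrak b$ be a fractional ideal of $K$ and let $\nu\in(\mathfrak b\mathfrak d)^{-1}$. Then, for all $y=(y_1,y_2)\in(\mathbb R_{>0})^2$, $$\bigl|\tilde b_1^B(\mathfrak b,\nu,y)\bigr|\le\frac{4B\pi^2}{\operatorname{vol}(\mathfrak b)}\exp\bigl(-2\pi\max(|\nu y_1|,|\nu'y_2|)\bigr).$$
   Context: $K\subset\mathbb R$ is a real quadratic field of discriminant $D$ ($\sqrt D>0$), $x\mapsto x'$ conjugation, $\mathfrak d=\sqrt D\,\mathcal O_K$; ideals are nonzero fractional ideals with norm $N(\mathfrak b)>0$, and $\operatorname{vol}(\mathfrak b)=N(\mathfrak b)\sqrt D$. $e(w)=e^{2\pi iw}$, $z=(z_1,z_2)=(x_1+iy_1,x_2+iy_2)\in\mathbb H^2$, $\operatorname{tr}(\nu x)=\nu x_1+\nu'x_2$. The function $\tilde H_s^B(\mathfrak b,z)=\sum_{\mu\in\mathfrak b}\Bigl(1+\frac{|(z_1+\mu)(z_2+\mu')+B|^2}{4y_1y_2B}\Bigr)^{-s}$ is invariant under translations by $\mathfrak b$, with Fourier expansion $\tilde H_s^B(\mathfrak b,z)=\sum_{\nu\in(\mathfrak b\mathfrak d)^{-1}}\tilde b_s^B(\mathfrak b,\nu,y)e(\operatorname{tr}(\nu x))$, whose coefficients are $$\tilde b_s^B(\mathfrak b,\nu,y)=\frac1{\operatorname{vol}(\mathfrak b)}\int_{\mathbb R^2}\Bigl(1+\frac{|z_1z_2+B|^2}{4y_1y_2B}\Bigr)^{-s}e(-\operatorname{tr}(\nu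 x))\,dx_1dx_2.$$ *)

(* Defs.v *)
From HB Require Import structures.
From mathcomp Require Import all_boot all_order all_algebra all_field.
From mathcomp Require Import all_classical all_reals all_analysis.
From mathcomp Require Import finmap complex.
Set Implicit Arguments.
Unset Strict Implicit.
Unset Printing Implicit Defensive.
Import Order.TTheory GRing.Theory Num.Theory.
Import numFieldNormedType.Exports.

Local Open Scope classical_set_scope.
Local Open Scope ring_scope.
Local Open Scope complex_scope.

(** [K] is a degree-2 extension of the rationals, [sigma] its nontrivial
    automorphism (x |-> x'), and [iota : K -> R] the inclusion of [K] into the
    reals.  (Fractional) ideals are subsets of [K]. *)

Section QuadraticField.
Variables (R : realType) (K : fieldExtType rat).
Variables (sigma : {rmorphism K -> K}) (iota : {rmorphism K -> R}).

Definition ring_of_integers : set K :=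
  [set x | integralOver (intr : int -> K) x].

Local Notation OK := ring_of_integers.

Definition integral_basis (w : 'I_2 -> K) : Prop :=
  (forall c : 'I_2 -> int, \sum_(i < 2) (c i)%:~R * w i = 0 ->
     forall i, c i = 0) /\
  OK = [set x | exists c : 'I_2 -> int, x = \sum_(i < 2) (c i)%:~R * w i].

(* det (sigma_i w_j) ^ 2, where sigma_0 = id and sigma_1 = sigma *)
Definition has_discriminant (D : int) : Prop :=
  exists2 w : 'I_2 -> K, integral_basis w &
    D%:~R = (\det (\matrix_(i < 2, j < 2) iter i sigma (w j))) ^+ 2.

Definition fractional_ideal (a : set K) : Prop :=
  [/\ a 0,
      forall x y, a x -> a y -> a (x + y),
      forall r x, OK r -> a x -> a (r * x),
      exists2 x, a x & x != 0
    & exists d, [/\ OK d, d != 0 & forall x, a x -> OK (d * x)]].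

Definition ideal_mul (a b : set K) : set K :=
  [set x | exists n (u v : 'I_n -> K),
     [/\ forall i, a (u i), forall i, b (v i) & x = \sum_(i < n) u i * v i]].

Definition ideal_inv (a : set K) : set K :=
  [set x | forall y, a y -> OK (x * y)].

(* The different sqrt(D) OK, where sqrt(D) is the positive root: the equation
   iota x = sqrt(D) iota(r) is read in R. *)
Definition different (D : int) : set K :=
  [set x | exists2 r, OK r & iota x = Num.sqrt D%:~R * iota r].

(* #(OK / a) for a nonzero ideal a contained in OK *)
Definition ideal_index (a : set K) : nat :=
  #|` fset_set
        [set C : set K | exists2 x, OK x & C = [set (x + y)%R | y in a]] |.

Definition common_denominator (a : set K) : K :=
  xget 1 [set d | [/\ OK d, d != 0 & forall x, a x -> OK (d * x)]].

(* N(a) = #(OK / d a) / |N(d)|; this does not depend on the choice of the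
   common denominator d. *)
Definition ideal_norm (a : set K) : R :=
  let d := common_denominator a in
  (ideal_index [set d * x | x in a])%:R / `|iota (d * sigma d)|.

Definition ideal_vol (D : int) (a : set K) : R :=
  ideal_norm a * Num.sqrt D%:~R.

End QuadraticField.

Section FourierCoefficient.
Variable R : realType.

Definition Cexp (w : R[i]) : R[i] :=
  (expR (complex.Re w))%:C * (cos (complex.Im w) +i* sin (complex.Im w)).

Definition e (w : R[i]) : R[i] := Cexp ((0 +i* (2 * pi)) * w).

(* t ^ s for a positive real t *)
Definition Cpow (t : R) (s : R[i]) : R[i] := Cexp (s * (ln t)%:C).

Local Notation lebesgue2 := (@lebesgue_measure R \x @lebesgue_measure R)%E.

Definition Cintegral2 (f : R * R -> R[i]) : R[i] :=
  Rintegral lebesgue2 setT (fun x => complex.Re (f x)) +i*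
  Rintegral lebesgue2 setT (fun x => complex.Im (f x)).

Variables (K : fieldExtType rat).
Variables (sigma : {rmorphism K -> K}) (iota : {rmorphism K -> R}).

Definition trace_pairing (nu : K) (x : R * R) : R :=
  iota nu * x.1 + iota (sigma nu) * x.2.

Definition kernel_base (B : R) (x y : R * R) : R :=
  let z1 := x.1 +i* y.1 in
  let z2 := x.2 +i* y.2 in
  1 + ComplexField.Normc.normc (z1 * z2 + B%:C) ^+ 2 / (4 * y.1 * y.2 * B).

Definition fourier_coef (D : int) (s : R[i]) (B : R) (b : set K) (nu : K)
    (y : R * R) : R[i] :=
  ((ideal_vol sigma iota D b)^-1)%:C *
  Cintegral2 (fun x =>
    Cpow (kernel_base B x y) (- s) * e (- (trace_pairing nu x)%:C)).

End FourierCoefficient.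

(* Main.v *)
Require Import Defs.
From mathcomp Require Import all_boot all_order all_algebra all_field.
From mathcomp Require Import all_classical all_reals all_analysis.
From mathcomp Require Import measurable_realfun ring lra.
From mathcomp Require Import complex.
Import Order.TTheory GRing.Theory Num.Theory.
Import numFieldNormedType.Exports.
Local Open Scope classical_set_scope.
Local Open Scope ring_scope.

(** The inverse of the volume is a nonnegative factor common to both sides;
    what remains is a bound for a double integral over the plane with the
    frequencies 2 pi nu and 2 pi nu'.

    At s = 1 the integrand is an oscillating factor times the reciprocal of
    the kernel, and completing the square gives
      4 y1 y2 B + |z1 z2 + B|^2 = |z1 conj(z2) + B|^2
                                = |z2|^2 ((x1 + u)^2 + v^2)
    with u = B x2 / |z2|^2 and v = y1 + B y2 / |z2|^2
    ([inv_kernel_cauchy]).  For fixed x2 this is a Cauchy density in x1 of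
    width v >= y1, whose Fourier transform is explicit, so the integral over
    x1 has modulus
      4 y1 y2 B / |z2|^2 * (pi / v) * exp(- |a| v)
        <= 4 B y2 pi exp(- |a| y1) / (x2^2 + y2^2),
    where a is the frequency ([integral_inv_kernel_le]).  Integrating over x2
    gives 4 B pi^2 exp(- |a| y1).  The kernel is symmetric in the two
    variables, so integrating in the other order yields the same bound with
    the other frequency and y2; Fubini makes both hold for the double
    integral, hence the maximum in the exponent.  The complex modulus is
    recovered from the real parts of all the rotations of the integral
    ([sqrt_addsqr_le]), so only real integrals with a phase are needed.

    The Fourier transform of 1 / (1 + t^2), with a phase p, is found from a
    differential equation ([cosint_lorentz]).  Let F and G be the cosine
    transforms of 1 / (1 + t^2) and of its square.  Integration by parts turns
    a F(a) into an integral that can be differentiated under the sign, and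
      G' = - a F / 2,   (a F)' = 2 (F - G).
    The space of solutions is spanned by F = exp(- a), G = (1 + a) exp(- a) / 2
    and F = exp(a), G = (1 - a) exp(a) / 2; as F and G are bounded, the growing
    solution does not occur ([bounded_solution]), so F(a) = F(0) exp(- a). *)

(** * Derivatives and integrals on the real line *)

Section RealLine.
Context {R : realType}.
Notation mu := (@lebesgue_measure R).

Lemma is_derive_cosM (t p x : R) :
  is_derive x 1 (fun a => cos (a * t + p)) (- (t * sin (x * t + p))).
Proof.
rewrite -[X in is_derive _ _ X _]/(cos \o (id * cst t + cst p)).
by apply: is_derive_eq; rewrite scaler0 add0r addr0 /GRing.scale/=; ring.
Qed.

Lemma continuous_cosM (a p : R) : continuous (fun t : R => cos (a * t + p)).
Proof.
move=> t; apply: continuous_comp; last exact: continuous_cos.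
by apply: cvgD; [apply: cvgM; [exact: cvg_cst|exact: cvg_id]|exact: cvg_cst].
Qed.

Lemma normr_cos_le1 (x : R) : `|cos x| <= 1.
Proof. by rewrite ler_norml cos_geN1 cos_le1. Qed.

Lemma derive0_cst_gt0 (f : R -> R) :
  (forall x : R, 0 < x -> is_derive x 1 f 0) ->
  forall x y, 0 < x -> 0 < y -> f x = f y.
Proof.
move=> df x y; wlog xy : x y / x <= y.
  by move=> H x0 y0; have [|/ltW] := lerP x y => ?; [|symmetry]; exact: H.
move=> x0 y0; have [z zxy||c _] := @MVT_segment R f (fun=> 0) x y xy.
- by apply: df; apply: lt_trans x0 _; move: zxy; rewrite in_itv => /andP[].
- apply: derivable_within_continuous => z zxy.
  have [] // := df z; apply: lt_le_trans x0 _.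
  by move: zxy; rewrite in_itv => /andP[].
- by rewrite mul0r => /eqP; rewrite subr_eq0 => /eqP.
Qed.

(** The integrals over [[-n, n]] equal [f n - f (- n)], and converge to the
    integral over the line by dominated convergence. *)
Lemma Rintegral_derive_eq0 (f f' : R -> R) : continuous f' ->
  mu.-integrable setT (EFin \o f') ->
  (forall x : R, is_derive x 1 f (f' x)) ->
  f n%:R @[n --> \oo] --> 0 -> f (- n%:R) @[n --> \oo] --> 0 ->
  \int[mu]_x f' x = 0.
Proof.
move=> cf' if' df fp fm.
pose g n := (EFin \o f') \_ `[- n%:R, n%:R].
have cvg1 : (\int[mu]_x g n x @[n --> \oo] --> \int[mu]_x (f' x)%:E)%E.
  have [] := @dominated_convergence _ _ _ mu setT measurableT g (EFin \o f')
     (abse \o (EFin \o f')).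
  - move=> n; apply/(measurable_restrictT (EFin \o f')) => //.
    by apply: measurable_funTS; case/integrableP : if'.
  - by case/integrableP : if'.
  - apply: aeW => x _; apply: cvg_near_cst.
    near=> n; rewrite /g patchE ifT// inE/= in_itv/= -ler_norml.
    by near: n; exact: nbhs_infty_ger.
  - exact: integrable_abse.
  - apply: aeW => x n _; rewrite /g patchE; case: ifPn => //= _.
    by rewrite normr0 lee_fin.
  - by move=> _ _.
have cf : continuous f.
  move=> x; apply: differentiable_continuous; apply/derivable1_diffP.
  by have [] := df x.
have e n : (\int[mu]_x g n x = (f n%:R - f (- n%:R))%:E)%E.
  rewrite /g -integral_mkcond.
  case: n => [|n]; first by rewrite oppr0 subrr set_itv1 integral_set1.
  rewrite (@continuous_FTC2 _ f' f) ?EFinB//.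
  - by rewrite gtrN.
  - exact: continuous_subspaceT.
  - split => [x _||]; first by have [] := df x.
      exact/cvg_at_right_filter/cf.
    exact/cvg_at_left_filter/cf.
  - by move=> x _; rewrite derive1E; have [] := df x.
have cvg2 : (\int[mu]_x g n x @[n --> \oo] --> 0%:E)%E.
  rewrite (funext e); apply: cvg_EFin; first exact: nearW.
  by rewrite -[X in _ --> X](subrr 0); apply: cvgB.
by rewrite /Rintegral (cvg_unique _ cvg1 cvg2).
Unshelve. all: by end_near. Qed.

(** The change of variables is made in the positive and in the negative part
    of [f] separately. *)
Lemma integral_affine (f : R -> R) (v u : R) : 0 < v -> continuous f ->
  (\int[mu]_x (f x)%:E = \int[mu]_t (f (v * t + u) * v)%:E)%E.
Proof.
move=> v0 cf.
pose L (t : R) := v * t + u.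
have dL (t : R) : is_derive t 1 L v.
  have did := is_derive_id t (1 : R).
  apply: is_derive_eq
    (is_deriveD (is_deriveZ v did) (is_derive_cst u t (1 : R))) _.
  by rewrite addr0 /GRing.scale/= mulr1.
have dLE : derive1 L = cst v.
  by apply/funext => t; rewrite derive1E; have [_ ->] := dL t.
have ge0_case (g : R -> R) : continuous g -> (forall x, 0 <= g x) ->
    (\int[mu]_x (g x)%:E = \int[mu]_t (g (v * t + u) * v)%:E)%E.
  move=> cg g0; rewrite (@increasing_ge0_integration_by_substitutionT _ L)//.
  - by apply: eq_integral => t _; rewrite dLE.
  - by move=> s t st; rewrite /L ltrD2r ltr_pM2l.
  - by rewrite dLE; exact: cst_continuous.
  - by rewrite dLE; exact: is_cvg_cst.
  - by rewrite dLE; exact: is_cvg_cst.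
  - by apply: cvg_comp (cvg_addrr_Ny _); apply: gt0_cvgMrNy.
  - by apply: cvg_comp (cvg_addrr _); apply: gt0_cvgMry.
rewrite integralE [RHS]integralE.
rewrite -/(EFin \o f) -/(EFin \o (fun t => f (v * t + u) * v)).
rewrite !funerpos !funerneg; congr (_ - _)%E.
  rewrite [LHS]ge0_case.
  + by apply: eq_integral => t _; rewrite /= /funrpos maxr_pMl ?mul0r ?ltW.
  + move=> x; rewrite /funrpos.
    have := @continuous_max R R f (cst 0) x (cf x) (@cst_continuous R R 0 x).
    exact.
  + by move=> x; rewrite le_max lexx orbT.
rewrite [LHS]ge0_case.
+ by apply: eq_integral => t _; rewrite /= /funrneg maxr_pMl ?mulNr ?mul0r ?ltW.
+ move=> x; rewrite /funrneg.
  have cNf : {for x, continuous (fun x => - f x)} by apply: cvgN; exact: cf.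
  have := @continuous_max R R _ (cst 0) x cNf (@cst_continuous R R 0 x).
  exact.
+ by move=> x; rewrite le_max lexx orbT.
Qed.

End RealLine.

(** * Cosine transforms of functions dominated by 1 / (1 + t^2) *)

Section CosineTransform.
Context {R : realType}.
Notation mu := (@lebesgue_measure R).

Definition lorentz (t : R) : R := (oneDsqr t)^-1.

Lemma lorentz_gt0 t : 0 < lorentz t.
Proof. by rewrite invr_gt0 (lt_le_trans ltr01). Qed.

Hint Resolve lorentz_gt0 : core.

Lemma continuous_lorentz : continuous lorentz.
Proof. exact: continuous_oneDsqrV. Qed.

Lemma integral_lorentz : (\int[mu]_x (lorentz x)%:E = pi%:E)%E.
Proof.
rewrite ge0_symfun_integralT//.
- rewrite -set_itvcy integral0y_oneDsqr -EFinM; congr EFin.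
  by rewrite mulrC divfK.
- by move=> x; exact: ltW.
- exact: continuous_lorentz.
- by move=> x; rewrite /= /lorentz /oneDsqr sqrrN.
Qed.

Lemma integrable_lorentz : mu.-integrable setT (EFin \o lorentz).
Proof.
apply/integrableP; split.
  apply/measurable_EFinP; apply: continuous_measurable_fun.
  exact: continuous_lorentz.
under eq_integral => x _ do rewrite /= ger0_norm ?(ltW (lorentz_gt0 x))//.
by rewrite integral_lorentz ltry.
Qed.

Lemma integrable_lorentzZ (C : R) :
  mu.-integrable setT (EFin \o (fun t => C * lorentz t)).
Proof.
have := integrableZl measurableT C integrable_lorentz.
by apply: eq_integrable => // x _ /=; rewrite EFinM.
Qed.

(** The phase [p] makes sines and cosines instances of one transform. *)
Definition cosint (w : R -> R) (p a : R) : R :=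
  \int[mu]_t (cos (a * t + p) * w t).

Lemma integrable_cosint (w : R -> R) (C p a : R) : continuous w ->
  (forall t, `|w t| <= C * lorentz t) ->
  mu.-integrable setT (EFin \o (fun t => cos (a * t + p) * w t)).
Proof.
move=> cw wC; apply: le_integrable (integrable_lorentzZ C) => //.
  apply/measurable_EFinP; apply: continuous_measurable_fun.
  by move=> t; apply: cvgM; [exact: continuous_cosM|exact: cw].
move=> t _; rewrite /= lee_fin (le_trans _ (ler_norm _))//.
by rewrite normrM (le_trans _ (wC t))// ler_piMl// normr_cos_le1.
Qed.

Lemma norm_cosint_le (w : R -> R) (C p a : R) : continuous w ->
  (forall t, `|w t| <= C * lorentz t) -> `|cosint w p a| <= C * pi.
Proof.
move=> cw wC; have iw := @integrable_cosint w C p a cw wC.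
rewrite (le_trans (le_normr_Rintegral _ iw))//.
have -> : C * pi = \int[mu]_t (C * lorentz t).
  rewrite RintegralZl//; last exact: integrable_lorentz.
  by rewrite /Rintegral integral_lorentz.
apply: le_Rintegral => //.
- exact: (integrable_norm iw).
- exact: integrable_lorentzZ.
- by move=> t _; rewrite normrM (le_trans _ (wC t))// ler_piMl// normr_cos_le1.
Qed.

Lemma continuous_cosint (w : R -> R) (C p : R) : continuous w ->
  (forall t, `|w t| <= C * lorentz t) -> continuous (cosint w p).
Proof.
move=> cw wC a.
apply: (@continuity_under_integral _ _ _ mu (fun b t => cos (b * t + p) * w t)
  setT measurableT (a - 1) (a + 1) _ _ _ (integrable_lorentzZ C)).
- by move=> b _; exact: integrable_cosint wC.
- apply: aeW => t _ b _; apply: cvgM; last exact: cvg_cst.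
  apply: continuous_comp; last exact: continuous_cos.
  by apply: cvgD; [apply: cvgM; [exact: cvg_id|exact: cvg_cst]|exact: cvg_cst].
- move=> b _; apply: aeW => t _.
  by rewrite normrM (le_trans _ (wC t))// ler_piMl// normr_cos_le1.
- by rewrite inE/= in_itv/= ltrBlDr ltrDl ltr01.
Qed.

(** Differentiation under the integral sign, with
    [- sin x = cos (x + pi / 2)]. *)
Lemma is_derive_cosint (w : R -> R) (C p a : R) : continuous w ->
  (forall t, `|w t| <= C * lorentz t) ->
  (forall t, `|t * w t| <= C * lorentz t) ->
  is_derive a 1 (cosint w p) (cosint (fun t => t * w t) (p + pi / 2) a).
Proof.
move=> cw wC twC.
pose f (b t : R) := cos (b * t + p) * w t.
have df (b t : R) :
    is_derive b 1 (f^~ t) (cos (b * t + (p + pi / 2)) * (t * w t)).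
  rewrite -[X in is_derive _ _ X _]/((fun b => cos (b * t + p)) * cst (w t)).
  have ? := @is_derive_cosM R t p b.
  apply: is_derive_eq.
  by rewrite scaler0 add0r addrA cosDpihalf /GRing.scale/=; ring.
have pE b t : partial1of2 f b t = cos (b * t + (p + pi / 2)) * (t * w t).
  by rewrite partial1of2E; have [_ ->] := df b t.
have aI : a \in `]a - 1, a + 1[%classic.
  by rewrite inE/= in_itv/= ltrBlDr ltrDl ltr01.
have intf b : `]a - 1, a + 1[%classic b -> mu.-integrable setT (EFin \o f b).
  by move=> _; exact: integrable_cosint wC.
have derf (b t : R) :
    `]a - 1, a + 1[%classic b -> setT t -> derivable (f^~ t) b 1.
  by move=> _ _; have [] := df b t.
have C0 t : 0 <= C * lorentz t by exact: le_trans (wC t).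
have f_le (b t : R) : `]a - 1, a + 1[%classic b -> setT t ->
    `|partial1of2 f b t| <= C * lorentz t.
  move=> _ _.
  by rewrite pE normrM (le_trans _ (twC t))// ler_piMl// normr_cos_le1.
have E : cosint (fun t => t * w t) (p + pi / 2) a =
    \int[mu]_t (partial1of2 f ^~ t) a.
  by apply: eq_Rintegral => t _; rewrite pE.
have iC := integrable_lorentzZ C.
split.
  exact: (derivable_under_integral measurableT (set_mem aI) intf derf C0 iC f_le).
rewrite -derive1E E.
exact: (differentiation_under_integral measurableT (set_mem aI) intf derf C0 iC
  f_le).
Qed.

(** * The differential equation *)

(** The general solution of the system is a combination of
    [F = exp (- a), G = (1 + a) exp (- a) / 2] and
    [F = exp a, G = (1 - a) exp a / 2].  On positive arguments the coefficient
    of the growing solution is a multiple of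
      [c a = ((1 + a) a F - 2 a G) exp (- a) / a ^ 2],
    a constant that boundedness forces to vanish; then [F exp] is constant. *)
Lemma bounded_solution (F G : R -> R) (C : R) : continuous F ->
  (forall x, `|F x| <= C) -> (forall x, `|G x| <= C) ->
  (forall a : R, is_derive a 1 (fun a : R => a * F a) (2 * (F a - G a))) ->
  (forall a : R, is_derive a 1 G (- (a * F a) / 2)) ->
  forall a, 0 <= a -> F a = F 0 * expR (- a).
Proof.
move=> cF bF bG dP dG.
(* [F] itself is not known to be differentiable: everything is expressed with
   the function [a * F a]. *)
pose P (a : R) := a * F a.
pose c (a : R) := ((1 + a) * P a - 2 * a * G a) * (expR (- a) * a^-1 ^+ 2).
have dE (x : R) : is_derive x 1 (fun x => expR (- x)) (- expR (- x)).
  rewrite -[X in is_derive _ _ X _]/(expR \o (-%R)).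
  by apply: is_derive_eq; rewrite /GRing.scale/=; ring.
have dV (x : R) : 0 < x -> is_derive x 1 (fun x => x^-1) (- x ^- 2).
  move=> x0; have := @is_deriveV _ id x 1 1 (lt0r_neq0 x0) _ => d.
  by apply: is_derive_eq (d _) _; rewrite /GRing.scale/= mulr1.
have dc (x : R) : 0 < x -> is_derive x 1 c 0.
  move=> x0; have ? := dV x x0; have ? := dG x.
  have ? : is_derive x 1 P (2 * (F x - G x)) by exact: dP.
  rewrite -[c]/(((cst 1 + id) * P - cst 2 * id * G) *
      ((fun x => expR (- x)) * (fun x => x^-1) ^+ 2)).
  apply: is_derive_eq; rewrite /GRing.scale/= /P.
  by rewrite !fctE; field; rewrite gt_eqF.
have c0 : c 1 = 0.
  apply/eqP; rewrite -normr_eq0; apply/negP => /negP c1.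
  have {}c1 : 0 < `|c 1| by rewrite lt_neqAle eq_sym c1 normr_ge0.
  have C0 : 0 <= C by exact: le_trans (bF 0).
  (* For a >= 1, |c a| <= C (3 + a) exp (- a) / a <= 4 C exp (- a), so
     |c 1| (1 + a) <= |c 1| exp a <= 4 C, which fails for this a. *)
  pose a := 1 + 4 * C / `|c 1|.
  have a1 : 1 <= a by rewrite lerDl divr_ge0 ?mulr_ge0.
  have a0 : 0 < a by exact: lt_le_trans a1.
  have aE : a = 1 + 4 * C / `|c 1| by [].
  clearbody a.
  have age0 : 0 <= a by exact: ltW.
  have e0 : 0 <= expR (- a) * a^-1 ^+ 2.
    by rewrite mulr_ge0 ?expR_ge0 ?exprn_ge0 ?invr_ge0.
  have ca : `|c 1| <= 4 * C * expR (- a).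
    rewrite (derive0_cst_gt0 _ dc _ _ ltr01 a0) /c normrM.
    rewrite (ger0_norm e0).
    rewrite mulrCA mulrC ler_pM2r ?expR_gt0// exprVn.
    rewrite ler_pdivrMr ?exprn_gt0//.
    rewrite (le_trans (ler_normB _ _))// /P !normrM.
    rewrite (ger0_norm (_ : 0 <= 1 + a)) ?(ger0_norm age0) ?addr_ge0//.
    rewrite (ger0_norm (_ : 0 <= 2))//.
    have h1 : (1 + a) * (a * `|F a|) <= (1 + a) * (a * C).
      by rewrite !ler_wpM2l ?addr_ge0.
    have h2 : 2 * a * `|G a| <= 2 * a * C.
      by apply: ler_wpM2l; [exact: mulr_ge0|exact: bG].
    have h3 : 0 <= C * (a * (a - 1)).
      by apply: mulr_ge0 => //; apply: mulr_ge0 => //; rewrite subr_ge0.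
    nra.
  have : `|c 1| * expR a <= 4 * C.
    by rewrite -ler_pdivlMr ?expR_gt0// -expRN.
  apply/negP; rewrite -ltNge (@lt_le_trans _ _ (`|c 1| * (1 + a)))//.
    rewrite aE !mulrDr mulr1 addrA mulrCA divff ?gt_eqF// mulr1.
    by rewrite ltrDr ltr_wpDl.
  by rewrite ler_pM2l// expR_ge1Dx.
have GE (x : R) : 0 < x -> 2 * G x = (1 + x) * F x.
  move=> x0; have /eqP := derive0_cst_gt0 _ dc _ _ x0 ltr01.
  rewrite c0 /c mulf_eq0 (gt_eqF (_ : 0 < expR (- x) * _)); last first.
    by rewrite mulr_gt0 ?expR_gt0 ?exprn_gt0 ?invr_gt0.
  rewrite orbF /P (_ : _ - _ = x * ((1 + x) * F x - 2 * G x)); last ring.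
  by rewrite mulf_eq0 gt_eqF//= subr_eq0 => /eqP.
pose d (a : R) := P a * (expR a * a^-1).
have dd (x : R) : 0 < x -> is_derive x 1 d 0.
  move=> x0; have ? := dV x x0.
  have ? : is_derive x 1 P (2 * (F x - G x)) by exact: dP.
  rewrite -[d]/(P * (expR * (fun x => x^-1))).
  apply: is_derive_eq; rewrite /GRing.scale/= !fctE /P mulrBr GE//.
  by field; rewrite gt_eqF.
have dF (x : R) : 0 < x -> d x = F x * expR x.
  by move=> x0; rewrite /d /P; field; rewrite gt_eqF.
have F0 : d 1 = F 0.
  have h1 : (F x * expR x) @[x --> 0^'+] --> F 0 * expR 0.
    by apply: cvgM; apply: cvg_at_right_filter;
      [exact: cF|exact: continuous_expR].
  rewrite -[RHS]mulr1 -expR0; apply: (cvg_unique _ _ h1) => //.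
  apply: cvg_near_cst; near=> x.
  by rewrite -dF//; apply: derive0_cst_gt0.
move=> a; rewrite le_eqVlt => /predU1P[<-|a0]; first by rewrite oppr0 expR0 mulr1.
rewrite -F0 (derive0_cst_gt0 _ dd _ _ ltr01 a0) dF// expRN mulfK//.
by rewrite gt_eqF ?expR_gt0.
Unshelve. all: by end_near. Qed.

(** * The cosine transform of 1 / (1 + t^2) *)

Lemma oneDsqrM_lorentz (t : R) : (1 + t ^+ 2) * lorentz t = 1.
Proof.
by rewrite divff// gt_eqF// (lt_le_trans ltr01)// (oneDsqr_ge1 t).
Qed.

Lemma lorentz_le1 t : lorentz t <= 1.
Proof. exact: oneDsqrV_le1. Qed.

Lemma continuous_lorentz2 : continuous (fun t => lorentz t ^+ 2).
Proof.
by move=> t; apply: (cvgM (continuous_lorentz t) (continuous_lorentz t)).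
Qed.

Lemma continuous_idM_lorentz2 : continuous (fun t : R => t * lorentz t ^+ 2).
Proof.
by move=> t; apply: cvgM; [exact: cvg_id|exact: continuous_lorentz2].
Qed.

Lemma norm_lorentz_le t : `|lorentz t| <= 1 * lorentz t.
Proof. by rewrite mul1r ger0_norm// ltW. Qed.

Lemma norm_lorentz2_le t : `|lorentz t ^+ 2| <= 1 * lorentz t.
Proof.
rewrite mul1r normrX (ger0_norm (ltW (lorentz_gt0 t))).
by rewrite expr2 ler_piMl ?lorentz_le1// ltW.
Qed.

Lemma norm_idM_lorentz2_le t : `|t * lorentz t ^+ 2| <= 1 * lorentz t.
Proof.
have t2 : `|t| <= 1 + t ^+ 2.
  rewrite -real_normK ?num_real//; set u := `|t|.
  by have := sqr_ge0 (u - 1); nra.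
rewrite mul1r normrM normrX (ger0_norm (ltW (lorentz_gt0 t))).
rewrite (le_trans (ler_wpM2r _ t2)) ?sqr_ge0//.
by rewrite expr2 mulrA oneDsqrM_lorentz mul1r.
Qed.

Lemma norm_sqrM_lorentz2_le t : `|t * (t * lorentz t ^+ 2)| <= 1 * lorentz t.
Proof.
rewrite mul1r mulrA -!expr2 -exprMn ger0_norm ?sqr_ge0//.
have := oneDsqrM_lorentz t; have := lorentz_gt0 t; rewrite exprMn => h0 e.
have t2 : t ^+ 2 * lorentz t <= 1 by rewrite -e ler_pM2r// lerDr.
by rewrite (expr2 (lorentz t)) mulrA ler_piMl// ltW.
Qed.

Lemma is_derive_lorentz (t : R) :
  is_derive t 1 lorentz (- (2 * t * lorentz t ^+ 2)).
Proof.
have o0 : oneDsqr t != 0 by rewrite gt_eqF// (lt_le_trans ltr01).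
have d : is_derive t 1 (@oneDsqr R) (2 * t).
  have did := is_derive_id t (1 : R).
  apply: is_derive_eq
    (is_deriveD (is_derive_cst (1 : R) t (1 : R)) (is_deriveX 2 did)) _.
  by rewrite add0r /GRing.scale/= mulr1.
have /(is_derive_eq) := is_deriveV o0 d; apply.
by rewrite /GRing.scale/= /lorentz exprVn; ring.
Qed.

(** Integration by parts: the derivative of
    [cos (a * t + (p - pi / 2)) * lorentz t] integrates to 0. *)
Lemma cosint_lorentz_by_parts p a : a * cosint lorentz p a =
  - 2 * cosint (fun t => t * lorentz t ^+ 2) (p + pi / 2) a.
Proof.
have iF := @integrable_cosint lorentz 1 p a continuous_lorentz norm_lorentz_le.
have iT := @integrable_cosint _ 1 (p + pi / 2) a continuous_idM_lorentz2
  norm_idM_lorentz2_le.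
pose f (t : R) := cos (a * t + (p - pi / 2)) * lorentz t.
pose f' (t : R) := a * (cos (a * t + p) * lorentz t) +
  2 * (cos (a * t + (p + pi / 2)) * (t * lorentz t ^+ 2)).
have if1 : mu.-integrable setT
    (EFin \o (fun t => a * (cos (a * t + p) * lorentz t))).
  have := integrableZl measurableT a iF.
  by apply: eq_integrable => // x _ /=; rewrite -EFinM.
have if2 : mu.-integrable setT
    (EFin \o (fun t => 2 * (cos (a * t + (p + pi / 2)) * (t * lorentz t ^+ 2)))).
  have := integrableZl measurableT 2 iT.
  by apply: eq_integrable => // x _ /=; rewrite -EFinM.
have int0 : \int[mu]_t f' t = 0.
  have cvg0 (s : R) : s ^+ 2 = 1 -> f (s * n%:R) @[n --> \oo] --> 0.
    move=> s1; apply: norm_cvg0.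
    have hn : (n.+1%:R^-1 : R) @[n --> \oo] --> 0 by exact: cvg_harmonic.
    apply: (@squeeze_cvgr _ _ _ _ (cst 0) (fun n : nat => 2 * n.+1%:R^-1)) => //.
    + apply: nearW => n; rewrite normr_ge0/= normrM.
      rewrite (@le_trans _ _ (lorentz (s * n%:R)))//.
        rewrite (ger0_norm (ltW (lorentz_gt0 _))) ler_piMl ?normr_cos_le1//.
        exact: ltW.
      have := oneDsqrM_lorentz (s * n%:R); rewrite exprMn s1 mul1r => e.
      have h0 := lorentz_gt0 (s * n%:R).
      have n1 : n%:R + 1 <= 2 * (1 + n%:R ^+ 2) :> R.
        by set u := n%:R; have := sqr_ge0 (4 * u - 1); nra.
      rewrite ler_pdivlMr ?ltr0n// -natr1 (le_trans (ler_wpM2l (ltW h0) n1))//.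
      by rewrite mulrCA (mulrC (lorentz _)) e mulr1.
    + exact: cvg_cst.
    + by rewrite -(mulr0 2); apply: cvgM => //; exact: cvg_cst.
  apply: (@Rintegral_derive_eq0 _ f f').
  - move=> t; apply: cvgD; (apply: cvgM; first exact: cvg_cst); apply: cvgM.
    + exact: continuous_cosM.
    + exact: continuous_lorentz.
    + exact: continuous_cosM.
    + exact: continuous_idM_lorentz2.
  - have := integrableD measurableT if1 if2.
    by apply: eq_integrable => // t _; rewrite /= -EFinD.
  - move=> t.
    rewrite -[f]/((fun t => cos (a * t + (p - pi / 2))) * lorentz).
    have d1 : is_derive t 1 (fun t => cos (a * t + (p - pi / 2)))
        (- (a * sin (t * a + (p - pi / 2)))).
      under eq_fun do rewrite (mulrC a).
      exact: is_derive_cosM.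
    have := is_derive_lorentz t => d2.
    apply: is_derive_eq; rewrite /GRing.scale/= /f'.
    have -> : t * a + (p - pi / 2) = a * t + p - pi / 2 by ring.
    rewrite sinBpihalf.
    have -> : a * t + (p - pi / 2) = a * t + p - pi / 2 by ring.
    rewrite cosBpihalf addrA cosDpihalf; ring.
  - have := cvg0 1 (expr1n _ _); under eq_fun do rewrite mul1r; exact.
  - have := cvg0 (-1) (etrans (sqrrN _) (expr1n _ _)).
    under eq_fun do rewrite mulN1r; exact.
move: int0; rewrite /f' RintegralD// !RintegralZl// -/(cosint _ _ _).
by rewrite -/(cosint _ _ _) => e; lra.
Qed.

Lemma is_derive_cosint_lorentz2 (p a : R) :
  is_derive a 1 (cosint (fun t => lorentz t ^+ 2) p)
    (- (a * cosint lorentz p a) / 2).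
Proof.
have := @is_derive_cosint _ 1 p a continuous_lorentz2 norm_lorentz2_le
  norm_idM_lorentz2_le.
by rewrite cosint_lorentz_by_parts => d; apply: is_derive_eq d _; field.
Qed.

(** Differentiating [cosint_lorentz_by_parts] once more brings out the weight
    [t ^+ 2 * lorentz t ^+ 2 = lorentz t - lorentz t ^+ 2]. *)
Lemma is_derive_idM_cosint_lorentz (p a : R) :
  is_derive a 1 (fun a : R => a * cosint lorentz p a)
    (2 * (cosint lorentz p a - cosint (fun t => lorentz t ^+ 2) p a)).
Proof.
under eq_fun do rewrite cosint_lorentz_by_parts.
have d := @is_derive_cosint _ 1 (p + pi / 2) a continuous_idM_lorentz2
  norm_idM_lorentz2_le norm_sqrM_lorentz2_le.
rewrite -[X in is_derive _ _ X _]/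
  (-2 \*: cosint (fun t => t * lorentz t ^+ 2) (p + pi / 2)).
apply: is_derive_eq; rewrite /GRing.scale/=.
have -> : cosint (fun t => t * (t * lorentz t ^+ 2)) (p + pi / 2 + pi / 2) a =
    cosint (fun t => lorentz t ^+ 2) p a - cosint lorentz p a.
  rewrite /cosint -RintegralB//;
    [|exact: integrable_cosint continuous_lorentz2 norm_lorentz2_le
     |exact: integrable_cosint continuous_lorentz norm_lorentz_le].
  apply: eq_Rintegral => t _; rewrite -addrA -splitr addrA cosDpi.
  have e : lorentz t = (1 + t ^+ 2) * lorentz t ^+ 2.
    by rewrite (expr2 (lorentz t)) mulrA oneDsqrM_lorentz mul1r.
  rewrite [X in _ = _ - _ * X]e; ring.
by ring.
Qed.

Lemma cosint_lorentz (p a : R) :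
  cosint lorentz p a = pi * cos p * expR (- `|a|).
Proof.
have pos (b q : R) : 0 <= b -> cosint lorentz q b = pi * cos q * expR (- b).
  move=> b0.
  have -> := @bounded_solution (cosint lorentz q)
    (cosint (fun t => lorentz t ^+ 2) q) pi _ _ _
    (is_derive_idM_cosint_lorentz q) (is_derive_cosint_lorentz2 q) b b0.
  - rewrite /cosint; congr (_ * _).
    under eq_Rintegral do rewrite mul0r add0r.
    rewrite RintegralZl//; last exact: integrable_lorentz.
    by rewrite /Rintegral integral_lorentz mulrC.
  - exact: continuous_cosint continuous_lorentz norm_lorentz_le.
  - move=> x; rewrite -[leRHS]mul1r.
    exact: norm_cosint_le continuous_lorentz norm_lorentz_le.
  - move=> x; rewrite -[leRHS]mul1r.
    exact: norm_cosint_le continuous_lorentz2 norm_lorentz2_le.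
have [a0|a0] := lerP 0 a; first by rewrite pos// ger0_norm.
rewrite -(cosN p) -pos// (ltr0_norm a0).
apply: eq_Rintegral => t _; rewrite -cosN; congr (cos _ * _).
by rewrite opprD mulNr.
Qed.

End CosineTransform.

(** * Fourier transform of the Cauchy densities *)

Section Cauchy.
Context {R : realType}.
Notation mu := (@lebesgue_measure R).

Lemma sqr_addsqr_gt0 (v x : R) : 0 < v -> 0 < x ^+ 2 + v ^+ 2.
Proof. by move=> v0; rewrite ltr_wpDl ?sqr_ge0 ?exprn_gt0. Qed.

Lemma continuous_cauchy (u v : R) : 0 < v ->
  continuous (fun x : R => ((x + u) ^+ 2 + v ^+ 2)^-1).
Proof.
move=> v0 x; apply: cvgV; first by rewrite gt_eqF// sqr_addsqr_gt0.
apply: cvgD; last exact: cvg_cst.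
by apply: (cvgM (cvgD cvg_id (cvg_cst _)) (cvgD cvg_id (cvg_cst _))).
Qed.

Lemma continuous_cos_cauchy (u v a q : R) : 0 < v ->
  continuous (fun x : R => cos (a * x + q) * ((x + u) ^+ 2 + v ^+ 2)^-1).
Proof.
by move=> v0 x; apply: cvgM; [exact: continuous_cosM|exact: continuous_cauchy].
Qed.

(** The substitution [x = v * t - u] reduces this to [cosint_lorentz]; the
    translation only changes the phase. *)
Lemma integral_cos_cauchy (u v a q : R) : 0 < v ->
  (\int[mu]_x (cos (a * x + q) * ((x + u) ^+ 2 + v ^+ 2)^-1)%:E =
   (pi / v * cos (q - a * u) * expR (- (`|a| * v)))%:E)%E.
Proof.
move=> v0.
rewrite (integral_affine _ v (- u) v0); last exact: continuous_cos_cauchy.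
have e (t : R) :
   cos (a * (v * t - u) + q) * ((v * t - u + u) ^+ 2 + v ^+ 2)^-1 * v =
   v^-1 * (cos (a * v * t + (q - a * u)) * lorentz t).
  have o0 : oneDsqr t != 0 by rewrite gt_eqF// (lt_le_trans ltr01).
  have -> : a * (v * t - u) + q = a * v * t + (q - a * u) by ring.
  rewrite subrK (_ : _ ^+ 2 + _ = v ^+ 2 * oneDsqr t); last first.
    by rewrite /oneDsqr; ring.
  by rewrite /lorentz; field; rewrite o0 gt_eqF.
under eq_integral do rewrite e.
have i := integrable_cosint _ 1 (q - a * u) (a * v) continuous_lorentz
  norm_lorentz_le.
under eq_integral do rewrite EFinM.
rewrite integralZl//.
rewrite -[X in (_ * X)%E]fineK; last exact: integrable_fin_num.
rewrite -EFinM; congr EFin.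
rewrite -[X in _ * X]/(cosint lorentz (q - a * u) (a * v)).
rewrite cosint_lorentz normrM (ger0_norm (ltW v0)); ring.
Qed.

Lemma integral_cauchy (v : R) : 0 < v ->
  (\int[mu]_x ((x ^+ 2 + v ^+ 2)^-1)%:E = (pi / v)%:E)%E.
Proof.
move=> v0; have := @integral_cos_cauchy 0 v 0 0 v0.
rewrite mul0r subrr cos0 normr0 mul0r oppr0 expR0 !mulr1 => <-.
by apply: eq_integral => x _; rewrite mul0r addr0 cos0 mul1r addr0.
Qed.

Lemma integrable_cos_cauchy (u v a q : R) : 0 < v ->
  mu.-integrable setT
    (EFin \o (fun x : R => cos (a * x + q) * ((x + u) ^+ 2 + v ^+ 2)^-1)).
Proof.
move=> v0; have w0 (x : R) : 0 <= ((x + u) ^+ 2 + v ^+ 2)^-1.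
  by rewrite invr_ge0 ltW// sqr_addsqr_gt0.
apply: (@le_integrable _ _ _ mu setT measurableT _
    (EFin \o (fun x : R => ((x + u) ^+ 2 + v ^+ 2)^-1))).
- apply/measurable_EFinP; apply: continuous_measurable_fun.
  exact: continuous_cos_cauchy.
- by move=> x _ /=; rewrite lee_fin normrM ler_piMl// normr_cos_le1.
apply/integrableP; split.
  apply/measurable_EFinP; apply: continuous_measurable_fun.
  exact: continuous_cauchy.
under eq_integral => x _ do rewrite /= ger0_norm//.
have E : (\int[mu]_x (((x + u) ^+ 2 + v ^+ 2)^-1)%:E =
    (pi / v * cos (0 - 0 * u) * expR (- (`|0 : R| * v)))%:E)%E.
  rewrite -(@integral_cos_cauchy u v 0 0 v0).
  by apply: eq_integral => x _; rewrite mul0r addr0 cos0 mul1r.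
by rewrite E ltry.
Qed.

Lemma integral_norm_le_cauchy (f : R -> \bar R) (A v : R) : 0 < v ->
  measurable_fun setT f ->
  (forall x, (`|f x| <= (A * (x ^+ 2 + v ^+ 2)^-1)%:E)%E) ->
  (\int[mu]_x `|f x| <= (A * (pi / v))%:E)%E.
Proof.
move=> v0 mf fA.
have i : mu.-integrable setT (EFin \o (fun x : R => (x ^+ 2 + v ^+ 2)^-1)).
  have := @integrable_cos_cauchy 0 v 0 0 v0.
  by apply: eq_integrable => // x _; rewrite /= mul0r !addr0 cos0 mul1r.
rewrite EFinM -integral_cauchy// -integralZl//.
apply: ge0_le_integral => //.
- exact: measurableT_comp.
- by apply: measurable_funeM; exact: measurable_int i.
Qed.

End Cauchy.

(** * The reciprocal kernel *)

Section InverseKernel.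
Context {R : realType}.
Notation mu := (@lebesgue_measure R).
Notation mu2 := (mu \x mu)%E.

(** The denominator is the squared modulus of z1 * conj(z2) + B. *)
Definition inv_kernel (y1 y2 B x1 x2 : R) : R :=
  4 * y1 * y2 * B / ((x1 * x2 + y1 * y2 + B) ^+ 2 + (x1 * y2 - x2 * y1) ^+ 2).

Lemma inv_kernelC y1 y2 B x1 x2 :
  inv_kernel y1 y2 B x1 x2 = inv_kernel y2 y1 B x2 x1.
Proof. by rewrite /inv_kernel; congr (_ / _); ring. Qed.

Definition inv_kernel_cos (y1 y2 B a c q : R) (x : R * R) : R :=
  inv_kernel y1 y2 B x.1 x.2 * cos (a * x.1 + c * x.2 + q).

Section Bounds.
Context (y1 y2 B : R) (y1_gt0 : 0 < y1) (y2_gt0 : 0 < y2) (B_gt0 : 0 < B).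

Lemma inv_kernel_ge0 x1 x2 : 0 <= inv_kernel y1 y2 B x1 x2.
Proof. by rewrite divr_ge0 ?addr_ge0 ?sqr_ge0// !mulr_ge0// ltW. Qed.

Lemma inv_kernel_cauchy x1 x2 : let N := x2 ^+ 2 + y2 ^+ 2 in
  inv_kernel y1 y2 B x1 x2 = 4 * y1 * y2 * B / N *
   ((x1 + B * x2 / N) ^+ 2 + (y1 + B * y2 / N) ^+ 2)^-1.
Proof.
move=> N; have N0 : 0 < N by exact: sqr_addsqr_gt0.
have expand (M : R) : M != 0 ->
    M * ((x1 + B * x2 / M) ^+ 2 + (y1 + B * y2 / M) ^+ 2) =
    M * (x1 ^+ 2 + y1 ^+ 2) + 2 * B * (x1 * x2 + y1 * y2) +
    B ^+ 2 * (x2 ^+ 2 + y2 ^+ 2) / M.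
  by move=> M0; field.
have h : (x1 * x2 + y1 * y2 + B) ^+ 2 + (x1 * y2 - x2 * y1) ^+ 2 =
  N * ((x1 + B * x2 / N) ^+ 2 + (y1 + B * y2 / N) ^+ 2).
  by rewrite expand ?gt_eqF// mulfK ?gt_eqF// /N; ring.
by rewrite /inv_kernel h invfM mulrA.
Qed.

(** The width [v = y1 + B * y2 / N] of the Cauchy density is at least [y1], in
    the factor [pi / v] as well as in the exponential. *)
Lemma integral_inv_kernel_le (x2 a q : R) :
  (`|\int[mu]_x1 (inv_kernel y1 y2 B x1 x2 * cos (a * x1 + q))%:E| <=
    (4 * B * y2 * pi * expR (- (`|a| * y1)) * (x2 ^+ 2 + y2 ^+ 2)^-1)%:E)%E.
Proof.
set N := x2 ^+ 2 + y2 ^+ 2; have N0 : 0 < N by exact: sqr_addsqr_gt0.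
set v := y1 + B * y2 / N; set u := B * x2 / N.
have y1v : y1 <= v by rewrite lerDl divr_ge0 ?mulr_ge0 ?ltW.
have v0 : 0 < v by exact: lt_le_trans y1v.
have i : mu.-integrable setT
    (EFin \o (fun x => cos (a * x + q) * ((x + u) ^+ 2 + v ^+ 2)^-1)).
  exact: integrable_cos_cauchy.
under eq_integral => x1 _.
  rewrite (_ : _ * _ = 4 * y1 * y2 * B / N *
      (cos (a * x1 + q) * ((x1 + u) ^+ 2 + v ^+ 2)^-1)).
    over.
  by rewrite inv_kernel_cauchy -/N -/u -/v; ring.
under eq_integral do rewrite EFinM.
rewrite integralZl// integral_cos_cauchy// -EFinM /= lee_fin.
have K0 : 0 <= 4 * y1 * y2 * B / N by rewrite divr_ge0 ?mulr_ge0 ?ltW.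
rewrite normrM (ger0_norm K0) !normrM.
rewrite (ger0_norm (expR_ge0 _)) (ger0_norm (pi_ge0 _)).
rewrite (ger0_norm (_ : 0 <= v^-1)) ?invr_ge0 ?(ltW v0)//.
have cos1 : `|cos (q - a * u)| <= 1 by exact: normr_cos_le1.
have vV : v^-1 <= y1^-1 by rewrite lef_pV2.
have e1 : expR (- (`|a| * v)) <= expR (- (`|a| * y1)).
  by rewrite ler_expR lerN2 ler_wpM2l.
have -> : 4 * B * y2 * pi * expR (- (`|a| * y1)) / N =
    4 * y1 * y2 * B / N * (pi * y1^-1 * 1 * expR (- (`|a| * y1))).
  by field; rewrite !gt_eqF.
apply: ler_wpM2l => //.
apply: ler_pM; rewrite ?expR_ge0 ?mulr_ge0 ?pi_ge0 ?invr_ge0 ?(ltW v0)//.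
apply: ler_pM; rewrite ?mulr_ge0 ?pi_ge0 ?invr_ge0 ?(ltW v0)//.
by rewrite ler_wpM2l ?pi_ge0.
Qed.

Lemma inv_kernel_den_gt0 (x1 x2 : R) :
  0 < (x1 * x2 + y1 * y2 + B) ^+ 2 + (x1 * y2 - x2 * y1) ^+ 2.
Proof.
(* |z1 conj(z2) + B|^2 = 4 y1 y2 B + |z1 z2 + B|^2 *)
rewrite (_ : _ + _ = 4 * y1 * y2 * B + ((x1 * x2 - y1 * y2 + B) ^+ 2 +
  (x1 * y2 + x2 * y1) ^+ 2)); last ring.
by rewrite ltr_wpDr ?addr_ge0 ?sqr_ge0// !mulr_gt0.
Qed.

Lemma measurable_inv_kernel :
  measurable_fun setT (fun x : R * R => inv_kernel y1 y2 B x.1 x.2).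
Proof.
(* exp o (-) o ln inverts the positive denominator by measurable steps. *)
rewrite (_ : (fun _ => _) = (fun x : R * R => 4 * y1 * y2 * B * expR (- ln
   ((x.1 * x.2 + y1 * y2 + B) ^+ 2 + (x.1 * y2 - x.2 * y1) ^+ 2)))); last first.
  by apply/funext => x; rewrite expRN lnK// posrE inv_kernel_den_gt0.
apply: measurable_funM => //; apply: measurableT_comp => //.
apply: measurableT_comp => //; apply: measurableT_comp => //.
apply: measurable_funD; apply: measurable_funX.
  do 2 apply: measurable_funD => //.
  by apply: measurable_funM.
by apply: measurable_funB; apply: measurable_funM.
Qed.

(** By Tonelli, this is the case of frequency 0 of the bound on the inner
    integral. *)
Lemma integrable_inv_kernel :
  mu2.-integrable setT (EFin \o (fun x : R * R => inv_kernel y1 y2 B x.1 x.2)).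
Proof.
have mk : measurable_fun setT
    (EFin \o (fun x : R * R => inv_kernel y1 y2 B x.1 x.2)).
  by apply/measurable_EFinP; exact: measurable_inv_kernel.
apply/integrable21ltyP => //.
have bound (x2 : R) : (`|\int[mu]_x1 (inv_kernel y1 y2 B x1 x2)%:E| <=
    (4 * B * y2 * pi * (x2 ^+ 2 + y2 ^+ 2)^-1)%:E)%E.
  have := integral_inv_kernel_le x2 0 0.
  rewrite normr0 mul0r oppr0 expR0 mulr1.
  by under eq_integral do rewrite mul0r addr0 cos0 mulr1.
have h := integral_norm_le_cauchy
  (fun x2 => \int[mu]_x1 (inv_kernel y1 y2 B x1 x2)%:E)%E _ y2 y2_gt0 _ bound.
have -> : (\int[mu]_x2 \int[mu]_x1
      `|(EFin \o (fun x : R * R => inv_kernel y1 y2 B x.1 x.2)) (x1, x2)| =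
    \int[mu]_x2 `|\int[mu]_x1 (inv_kernel y1 y2 B x1 x2)%:E|)%E.
  apply: eq_integral => x2 _; rewrite gee0_abs.
    by apply: eq_integral => x1 _; rewrite /= ger0_norm ?inv_kernel_ge0.
  by apply: integral_ge0 => x1 _; rewrite lee_fin inv_kernel_ge0.
apply: le_lt_trans (h _) _; last exact: ltry.
apply: (@measurable_fun_fubini_tonelli_G _ _ _ _ R mu _ mk) => x.
by rewrite lee_fin inv_kernel_ge0.
Qed.

Lemma integrable_inv_kernel_cos a c q :
  mu2.-integrable setT (EFin \o inv_kernel_cos y1 y2 B a c q).
Proof.
apply: le_integrable integrable_inv_kernel => //.
  apply/measurable_EFinP; apply: measurable_funM.
    exact: measurable_inv_kernel.
  apply: measurableT_comp.
    exact: continuous_measurable_fun (@continuous_cos R).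
  by apply: measurable_funD => //; apply: measurable_funD; apply: measurable_funM.
move=> x _.
by rewrite /= lee_fin /inv_kernel_cos normrM ler_piMr// normr_cos_le1.
Qed.

Lemma Rintegral_inv_kernel_cos_le1 a c q :
  `|Rintegral mu2 setT (inv_kernel_cos y1 y2 B a c q)| <=
  4 * B * pi ^+ 2 * expR (- (`|a| * y1)).
Proof.
have i := integrable_inv_kernel_cos a c q.
rewrite -lee_fin EFin_normr_Rintegral// -integral21_prod_meas1//.
set G := fubini_G _ _.
have mG : measurable_fun setT G by exact: (measurable_fubini_G i).
have bound (x2 : R) : (`|G x2| <=
    (4 * B * y2 * pi * expR (- (`|a| * y1)) * (x2 ^+ 2 + y2 ^+ 2)^-1)%:E)%E.
  rewrite /G /fubini_G /= /inv_kernel_cos /=.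
  under eq_integral do rewrite -addrA.
  exact: integral_inv_kernel_le.
apply: (le_trans (le_abse_integral mu measurableT mG)).
apply: le_trans (integral_norm_le_cauchy _ _ _ y2_gt0 mG bound) _.
by rewrite lee_fin le_eqVlt; apply/orP; left; apply/eqP; field; rewrite gt_eqF.
Qed.

End Bounds.

(** Integration in the other order: swapping the variables turns this into the
    bound on the inner integral with [y1] and [y2] exchanged. *)
Lemma Rintegral_inv_kernel_cos_le2 (y1 y2 B a c q : R) :
  0 < y1 -> 0 < y2 -> 0 < B ->
  `|Rintegral mu2 setT (inv_kernel_cos y1 y2 B a c q)| <=
  4 * B * pi ^+ 2 * expR (- (`|c| * y2)).
Proof.
move=> y10 y20 B0; have i := integrable_inv_kernel_cos _ _ _ y10 y20 B0 a c q.
rewrite -lee_fin EFin_normr_Rintegral// -integral12_prod_meas1//.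
set F := fubini_F _ _.
have mF : measurable_fun setT F by exact: (measurable_fubini_F i).
have bound (x1 : R) : (`|F x1| <=
    (4 * B * y1 * pi * expR (- (`|c| * y2)) * (x1 ^+ 2 + y1 ^+ 2)^-1)%:E)%E.
  rewrite /F /fubini_F /= /inv_kernel_cos /=.
  under eq_integral do rewrite inv_kernelC (addrC (a * x1)) -addrA.
  exact: integral_inv_kernel_le.
apply: (le_trans (le_abse_integral mu measurableT mF)).
apply: le_trans (integral_norm_le_cauchy _ _ _ y10 mF bound) _.
by rewrite lee_fin le_eqVlt; apply/orP; left; apply/eqP; field; rewrite gt_eqF.
Qed.

(** [sqrt (a ^ 2 + c ^ 2)] is attained by [a cos p - c sin p], at minus the
    argument of [a + i c]. *)
Lemma sqrt_addsqr_le (a c M : R) :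
  (forall p, a * cos p - c * sin p <= M) -> Num.sqrt (a ^+ 2 + c ^+ 2) <= M.
Proof.
move=> H; set r := Num.sqrt _.
have rE : r ^+ 2 = a ^+ 2 + c ^+ 2 by rewrite sqr_sqrtr ?addr_ge0 ?sqr_ge0.
have := sqrtr_ge0 (a ^+ 2 + c ^+ 2).
rewrite -/r le_eqVlt => /predU1P[r0|r0].
  have /eqP : a ^+ 2 + c ^+ 2 = 0 by rewrite -rE -r0 expr0n.
  rewrite paddr_eq0 ?sqr_ge0// sqrf_eq0 => /andP[/eqP a0 _].
  by have := H 0; rewrite cos0 sin0 a0 !mulr0 mul0r subr0 -r0.
pose x := a / r.
have x2 : x ^+ 2 + (c / r) ^+ 2 = 1.
  by rewrite !expr_div_n -mulrDl -rE divff// expf_neq0// gt_eqF.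
have x1 : -1 <= x <= 1.
  have xx : x ^+ 2 <= 1 by rewrite -x2 lerDl sqr_ge0.
  by apply/andP; split; nra.
pose p := if 0 <= c then - acos x else acos x.
have cosp : cos p = x by rewrite /p; case: ifP => _; rewrite ?cosN acosK.
have sinp : sin p = - (c / r).
  have s : sin (acos x) = `|c / r| by rewrite sin_acos// -x2 addrC addKr sqrtr_sqr.
  rewrite /p; case: (lerP 0 c) => c0; rewrite ?sinN s.
    by rewrite ger0_norm// divr_ge0// ltW.
  by rewrite ltr0_norm// pmulr_llt0 ?invr_gt0.
have := H p; rewrite cosp sinp mulrN opprK mulrA /x mulrA -mulrDl -!expr2 -rE.
by rewrite expr2 mulfK// gt_eqF.
Qed.

(** The phases 0 and pi / 2 give the real and the imaginary part of the
    Fourier integral; rotating the integral by [p] only shifts the phase. *)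
Lemma sqrt_inv_kernel_cos_le (y1 y2 B a c : R) : 0 < y1 -> 0 < y2 -> 0 < B ->
  Num.sqrt (Rintegral mu2 setT (inv_kernel_cos y1 y2 B a c 0) ^+ 2 +
            Rintegral mu2 setT (inv_kernel_cos y1 y2 B a c (pi / 2)) ^+ 2) <=
  4 * B * pi ^+ 2 * expR (- Num.max (`|a| * y1) (`|c| * y2)).
Proof.
move=> y10 y20 B0; apply: sqrt_addsqr_le => p.
set f := inv_kernel_cos y1 y2 B a c.
have i q : mu2.-integrable setT (EFin \o f q).
  exact: integrable_inv_kernel_cos.
have -> : Rintegral mu2 setT (f 0) * cos p -
    Rintegral mu2 setT (f (pi / 2)) * sin p = Rintegral mu2 setT (f (- p)).
  rewrite -(RintegralZr (cos p) measurableT (i 0)).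
  rewrite -(RintegralZr (sin p) measurableT (i (pi / 2))) -RintegralB//.
  - apply: eq_Rintegral => x _; rewrite /f /inv_kernel_cos addr0 cosDpihalf.
    rewrite cosB; ring.
  - have := integrableZr measurableT (cos p) (i 0).
    by apply: eq_integrable => // x _; rewrite /= EFinM.
  - have := integrableZr measurableT (sin p) (i (pi / 2)).
    by apply: eq_integrable => // x _; rewrite /= EFinM.
rewrite (le_trans (ler_norm _))//.
case: (leP (`|a| * y1) (`|c| * y2)) => _.
  exact: Rintegral_inv_kernel_cos_le2.
exact: Rintegral_inv_kernel_cos_le1.
Qed.

(** * The integrand of the Fourier coefficient *)

Lemma kernel_baseV (B : R) (x y : R * R) : 0 < B -> 0 < y.1 -> 0 < y.2 ->
  0 < kernel_base B x y /\
  (kernel_base B x y)^-1 = inv_kernel y.1 y.2 B x.1 x.2.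
Proof.
case: x y => [x1 x2] [y1 y2] /= B0 y10 y20.
rewrite /kernel_base /= sqr_sqrtr ?addr_ge0 ?sqr_ge0// !addr0.
have K0 : 0 < 4 * y1 * y2 * B by rewrite !mulr_gt0.
split; first by rewrite ltr_pwDl// divr_ge0 ?addr_ge0 ?sqr_ge0// ltW.
have [M ME M0] : exists2 M, M = 4 * y1 * y2 * B & 0 < M.
  by exists (4 * y1 * y2 * B).
rewrite /inv_kernel -!ME.
rewrite (_ : _ + (x1 * y2 - _) ^+ 2 =
  M * (1 + ((x1 * x2 - y1 * y2 + B) ^+ 2 + (x1 * y2 + y1 * x2) ^+ 2) / M)).
  by rewrite invfM mulrA divff ?gt_eqF// mul1r.
by rewrite mulrDr mulr1 mulrCA divff ?gt_eqF// mulr1 ME; ring.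
Qed.

Local Open Scope complex_scope.

Lemma CpowN1 (t : R) : 0 < t -> Cpow t (- 1) = (t^-1)%:C.
Proof.
move=> t0; rewrite /Cpow mulN1r /Cexp /= oppr0 cos0 sin0 expRN lnK ?posrE//.
by rewrite -complexr0 mulr1.
Qed.

Lemma e_oppr (t : R) :
  e (- t%:C) = cos (2 * pi * t) +i* - sin (2 * pi * t).
Proof.
have w : (0 +i* (2 * pi)) * - t%:C = 0 +i* - (2 * pi * t) :> R[i].
  by apply/eqP; rewrite eq_complex /=; apply/andP; split; apply/eqP; ring.
by rewrite /e w /Cexp /= expR0 mul1r cosN sinN.
Qed.

End InverseKernel.

Theorem lemma4p1 (R : realType) (K : fieldExtType rat)
    (hK : \dim {:K} = 2%N)
    (iota : {rmorphism K -> R})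
    (sigma : {rmorphism K -> K}) (hsigma : exists x : K, sigma x <> x)
    (D : int) (hD : has_discriminant sigma D)
    (B : R) (hB : 0 < B)
    (b : set K) (hb : fractional_ideal b)
    (nu : K) (hnu : ideal_inv (ideal_mul b (different iota D)) nu)
    (y : R * R) (hy1 : 0 < y.1) (hy2 : 0 < y.2) :
  ComplexField.Normc.normc (fourier_coef sigma iota D 1 B b nu y) <=
    4 * B * pi ^+ 2 / ideal_vol sigma iota D b *
    expR (- (2 * pi * Num.max `|iota nu * y.1| `|iota (sigma nu) * y.2|)).
Proof.
set a := iota nu; set c := iota (sigma nu); set E := expR _.
have vol0 : 0 <= ideal_vol sigma iota D b.
  by rewrite mulr_ge0 ?divr_ge0 ?sqrtr_ge0.
rewrite /fourier_coef ComplexField.Normc.normcM mulrAC mulrC.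
rewrite [X in _ * X](_ : _ = (ideal_vol sigma iota D b)^-1); last first.
  by rewrite /= expr0n addr0 sqrtr_sqr ger0_norm ?invr_ge0.
rewrite ler_wpM2r ?invr_ge0//.
pose f := inv_kernel_cos y.1 y.2 B (2 * pi * a) (2 * pi * c).
have fE x : Cpow (kernel_base B x y) (- 1) *
    e (- (trace_pairing sigma iota nu x)%:C%C) = (f 0 x +i* f (pi / 2) x)%C.
  have [k0 kE] := @kernel_baseV _ B x y hB hy1 hy2.
  have th : 2 * pi * a * x.1 + 2 * pi * c * x.2 =
      2 * pi * trace_pairing sigma iota nu x.
    by rewrite /trace_pairing -/a -/c; ring.
  rewrite CpowN1// e_oppr kE /f /inv_kernel_cos addr0 th cosDpihalf.
  by apply/eqP; rewrite eq_complex /=; apply/andP; split; apply/eqP; ring.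
rewrite (funext fE) /Cintegral2 /=.
have pi20 : 0 <= 2 * pi :> R by rewrite mulr_ge0 ?pi_ge0.
rewrite (le_trans (sqrt_inv_kernel_cos_le _ _ _ _ _ hy1 hy2 hB))// /E.
have normM2pi (z : R) : `|2 * pi * z| = 2 * pi * `|z|.
  by rewrite normrM ger0_norm.
rewrite !normM2pi -!(mulrA (2 * pi)) -maxr_pMr// !normrM.
by rewrite (gtr0_norm hy1) (gtr0_norm hy2).
Qed.
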